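(* Let $f(X)=a_{0}+a_{1}X+\cdots +a_{n}X^{n}\in \mathbb{Z}[X]$, $a_{0}a_{n}\neq 0$. Suppose there exist two distinct prime numbers $p$ and $q$ and two distinct indices $j_{1},j_{2}\in \{1,\dots ,n-1\}$ such that $j_{1}+j_{2}\neq n$ and (i) $\nu _{p}(a_{0}) = 0$; $\frac{\nu _{p}(a_{i})}{i} > \frac{\nu _{p}(a_{j_{1}})}{j_{1}}$ for $0<i<j_{1}$; $\nu _{p}(a_{j_{1}})>0$; $\nu _{p}(a_{i}) > \frac{n-i}{n-j_{1}}\, \nu _{p}(a_{j_{1}})+\frac{i-j_{1}}{n-j_{1}}\, \nu _{p}(a_{n})$ for $j_{1}<i<n$; and $\frac{\nu _{p}(a_{n})}{n}>\frac{\nu _{p}(a_{j_{1}})}{j_{1}}$; (ii) $\nu _{q}(a_{0}) = 0$; $\frac{\nu _{q}(a_{i})}{i} > \frac{\nu _{q}(a_{j_{2}})}{j_{2}}$ for $0<i<j_{2}$; $\nu _{q}(a_{j_{2}})>0$; $\nu _{q}(a_{i}) > \frac{n-i}{n-j_{2}}\, \nu _{q}(a_{j_{2}})+\frac{i-j_{2}}{n-j_{2}}\, \nu _{q}(a_{n})$ for $j_{2}<i<n$; and $\frac{\nu _{q}(a_{n})}{n}>\frac{\nu _{q}(a_{j_{2}})}{j_{2}}$; (iii) $\gcd(\nu _{p}(a_{j_{1}}),j_{1})=\gcd(\nu _{p}(a_{n})-\nu _{p}(a_{j_{1}}),n-j_{1})=1$ and $\gcd(\nu _{q}(a_{j_{2}}),j_{2})=\gcd(\nu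 _{q}(a_{n})-\nu _{q}(a_{j_{2}}),n-j_{2})=1$. Then $f$ is irreducible over $\mathbb{Q}$.
   Context: For a prime $p$ and a nonzero integer $m$, $\nu_p(m)$ is the largest integer $i$ such that $p^i\mid m$; by convention $\nu_p(0)=\infty$ (so lower bounds on $\nu_p(a_i)$ hold automatically when $a_i=0$). *)

(* Defs.v *)
From mathcomp Require Import all_boot all_order all_algebra.
From mathcomp Require Import constructive_ereal.

Set Implicit Arguments.
Unset Strict Implicit.
Unset Printing Implicit Defensive.

Import Order.TTheory GRing.Theory Num.Theory.

Local Open Scope ring_scope.

(* For p prime and m != 0 this is the largest i with p ^ i dividing m; at
   m = 0 it has the junk value 0, so it should only be used for m != 0. *)
Definition pval (p : nat) (m : int) : nat := logn p `|m|%N.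

(* The p-adic valuation with the convention nu p 0 = +oo. *)
Definition nu (p : nat) (m : int) : \bar rat :=
  if m == 0 then +oo%E else (pval p m)%:R%:E.

(* The lower convex hull of the points (i, nu_p(a_i)) has exactly the vertices
   (0, 0), (j, nu_p(a_j)), (n, nu_p(a_n)), with positive slopes, and every other
   point lies strictly above it.  The last conjunct forces a_j != 0 as soon as
   a_n != 0.  The natural-number subtractions are exact, because j < i < n
   wherever they occur. *)
Definition two_segment_polygon (p n j : nat) (f : {poly int}) : Prop :=
  [/\ nu p f`_0 = 0%E,
      forall i : nat, (0 < i < j)%N ->
        (nu p f`_i / i%:R%:E > nu p f`_j / j%:R%:E)%E,
      (nu p f`_j > 0)%E,
      forall i : nat, (j < i < n)%N ->
        (nu p f`_i > ((n - i)%:R / (n - j)%:R)%R%:E * nu p f`_j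
                   + ((i - j)%:R / (n - j)%:R)%R%:E * nu p f`_n)%E
    & (nu p f`_n / n%:R%:E > nu p f`_j / j%:R%:E)%E].

(* Main.v *)
Require Import Defs.
From mathcomp Require Import all_boot all_order all_algebra.
From mathcomp Require Import constructive_ereal.
From mathcomp Require Import zify ring lra.

(* By Gauss's lemma it suffices to treat f = g h over Z.  For a slope A / B put
   the weight B v_p(a_i) - A i on the i-th coefficient; its minimum over a
   polynomial is a supporting line of the Newton polygon.  If the minima for g
   and for h are each reached once, so is that of f, at the sum of the indices
   (Dumas).  Slopes infinitely close to those of the two segments of f have such
   unique minima, at 0, j and n.  They split j as k + l, where (k, v_p(g_k)) lies
   on an edge of g from (0, 0) parallel to the first segment of f, and
   (deg g, v_p(g_d)) on an edge from there parallel to the second.  As the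
   segments of f have no interior lattice points, k is 0 or j and deg g - k is 0
   or n - j.  Hence deg g is 0, j, n - j or n; the two primes p and q together
   only leave 0 and n. *)

Set Implicit Arguments.
Unset Strict Implicit.
Unset Printing Implicit Defensive.

Import Order.TTheory GRing.Theory Num.Theory.

Local Open Scope ring_scope.

(** * Supporting lines and their unique minima *)

Definition weight (p : nat) (A B : int) (g : {poly int}) (i : nat) : int :=
  B * (pval p g`_i)%:Z - A * i%:Z.

(** Zero coefficients are left out: their points lie at infinite height, whereas [pval] gives them
    the value 0. *)
Definition vertex (p : nat) (A B : int) (g : {poly int}) (k : nat) : Prop :=
  g`_k != 0 /\
  forall i, g`_i != 0 -> i != k -> weight p A B g k < weight p A B g i.

Lemma vertex_le p A B g k i :
  vertex p A B g k -> g`_i != 0 -> weight p A B g k <= weight p A B g i.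
Proof. by move=> [_ vk] gi; have [->|ik] := eqVneq i k; last exact/ltW/vk. Qed.

Lemma vertex_uniq p A B g k l : vertex p A B g k -> vertex p A B g l -> k = l.
Proof.
move=> vk vl; apply/eqP/negPn/negP => kl.
by have := le_lt_trans (vertex_le vl vk.1) (vk.2 l vl.1 _); rewrite ltxx eq_sym => /(_ kl).
Qed.

Lemma dvdz_pval p e m : prime p -> m != 0 ->
  (((p ^ e)%N : int) %| m)%Z = (e <= pval p m)%N.
Proof. by move=> pp m0; rewrite dvdzE pfactor_dvdn // absz_gt0. Qed.

Lemma pvalM p m1 m2 : m1 != 0 -> m2 != 0 ->
  pval p (m1 * m2) = (pval p m1 + pval p m2)%N.
Proof. by move=> m10 m20; rewrite /pval abszM lognM ?absz_gt0. Qed.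

(** Any pair of nonzero coefficients other than [g_k], [h_l] has larger total weight. So among the
    terms of index sum [k + l] only [g_k * h_l] has minimal valuation, and nothing can cancel it. *)
Lemma vertex_mul p (A B : int) (g h : {poly int}) k l : prime p -> 0 < B ->
  vertex p A B g k -> vertex p A B h l ->
  vertex p A B (g * h) (k + l) /\
  pval p (g * h)`_(k + l) = (pval p g`_k + pval p h`_l)%N.
Proof.
move=> pp B0 vk vl; have [gk mk] := vk; have [hl ml] := vl.
have gt0 i i' : g`_i != 0 -> h`_i' != 0 -> (i != k) || (i' != l) ->
    weight p A B g k + weight p A B h l < weight p A B g i + weight p A B h i'.
  move=> gi hi' /orP[ik|il].
    by apply: ltr_leD; [exact: mk|exact: vertex_le vl hi'].
  by apply: ler_ltD; [exact: vertex_le vk gi|exact: ml].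
(* If the point [(m, e)] has at most the minimal total weight, every nonzero term selected by [P]
   has valuation above [e]. *)
have sum_dvd m (P : pred 'I_m.+1) e :
    (forall i : 'I_m.+1, P i -> ((i : nat) != k) || ((m - i)%N != l)) ->
    (B * e%:Z - A * m%:Z <= weight p A B g k + weight p A B h l) ->
    (((p ^ e.+1)%N : int) %| (\sum_(i < m.+1 | P i) g`_i * h`_(m - i))%R)%Z.
  move=> Pi le_e; apply: (big_ind (fun x => ((p ^ e.+1)%N %| x)%Z)).
  - exact: dvdz0.
  - by move=> x y; exact: rpredD.
  move=> i /Pi Pki; have [->|gi] := eqVneq g`_i 0; first by rewrite mul0r dvdz0.
  have [->|hi] := eqVneq h`_(m - i) 0; first by rewrite mulr0 dvdz0.
  rewrite dvdz_pval ?mulf_neq0 // pvalM //.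
  have := le_lt_trans le_e (gt0 _ _ gi hi Pki).
  have im := ltn_ord i; have -> : m%:Z = i%:Z + (m - i)%N%:Z by lia.
  rewrite /weight -ltrBDr => lt_e.
  have : B * e%:Z < B * (pval p g`_i + pval p h`_(m - i))%N%:Z.
    by rewrite PoszD; lia.
  by rewrite ltr_pM2l.
have nzgh : g`_k * h`_l != 0 by rewrite mulf_neq0.
have [c eqc] : exists c : int, (g * h)`_(k + l) =
    g`_k * h`_l + c * ((p ^ (pval p g`_k + pval p h`_l).+1)%N : int).
  have lt_k : (k < (k + l).+1)%N by rewrite ltnS leq_addr.
  rewrite coefM (bigD1 (Ordinal lt_k)) //= addKn.
  have nek (i : 'I_(k + l).+1) : i != Ordinal lt_k ->
      ((i : nat) != k) || ((k + l - i)%N != l).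
    by move=> ik; rewrite -[i != k :> nat]/(i != Ordinal lt_k) ik.
  have le_e : B * (pval p g`_k + pval p h`_l)%N%:Z - A * (k + l)%N%:Z
      <= weight p A B g k + weight p A B h l by rewrite /weight !PoszD; lia.
  by have /dvdzP[c ->] := sum_dvd _ _ _ nek le_e; exists c.
have ndvd : ~~ (((p ^ (pval p g`_k + pval p h`_l).+1)%N : int) %| ((g * h)`_(k + l)))%Z.
  rewrite eqc.
  by rewrite (rpredDr _ (dvdz_mull _ (dvdzz _))) dvdz_pval // pvalM // ltnn.
have nz : (g * h)`_(k + l) != 0.
  by apply: contraNneq ndvd => ->; rewrite dvdz0.
have val : pval p (g * h)`_(k + l) = (pval p g`_k + pval p h`_l)%N.
  apply/eqP; rewrite eqn_leq leqNgt -dvdz_pval // ndvd -dvdz_pval //= eqc.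
  apply: rpredD; first by rewrite dvdz_pval // pvalM.
  by apply: dvdz_mull; rewrite dvdzE /= dvdn_exp2l.
(* Otherwise [sum_dvd], with [e] the valuation of the coefficient itself, yields one power of [p]
   too many. *)
split=> //; split=> // m nzm mkl; rewrite ltNge; apply/negP => le_m.
suff : (((p ^ (pval p (g * h)`_m).+1)%N : int) %| (g * h)`_m)%Z.
  by rewrite dvdz_pval // ltnn.
rewrite [X in X \in _]coefM; apply: (sum_dvd m predT) => [i _|].
  by rewrite -negb_and; apply: contraNN mkl => /andP[/eqP<- /eqP<-]; rewrite subnKC // -ltnS.
by move: le_m; rewrite /weight val !PoszD; lia.
Qed.

(* The perturbed slope (A + e / N) / B separates indices less than N apart. *)
Lemma vertex_exists p (A B e : int) N (g : {poly int}) : (e == 1) || (e == -1) -> g != 0 ->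
  (size g <= N)%N -> exists k, vertex p (A * N%:Z + e) (B * N%:Z) g k.
Proof.
move=> e1 g0 leN.
have lt0 : ((size g).-1 < size g)%N by rewrite prednK // lt0n size_poly_eq0.
have nz0 : g`_(Ordinal lt0) != 0 by rewrite -lead_coefE lead_coef_eq0.
case: (@Order.TotalTheory.arg_minP _ _ _ (Ordinal lt0) (fun i => g`_i != 0)
  (fun i => weight p (A * N%:Z + e) (B * N%:Z) g i) nz0) => k gk mink.
exists k; split=> // i gi ik.
have ig : (i < size g)%N by rewrite ltnNge; apply: contraNN gi => /leq_sizeP ->.
rewrite lt_neqAle (mink (Ordinal ig) gi) andbT; apply: contraNneq ik => eqw.
have kN := leq_trans (ltn_ord k) leN; have iN := leq_trans ig leN.
(* A tie between perturbed weights makes [N] divide [i - k]; both indices are below [N], so they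
   agree. *)
have [c {}eqw] : exists c : int, e * (i%:Z - k%:Z) = N%:Z * c.
  exists (weight p A B g i - weight p A B g k).
  by move: eqw; rewrite /weight; lia.
have [c0|[c0|c0]] : c = 0 \/ c <= -1 \/ 1 <= c by lia.
- by apply/eqP; case/orP: e1 eqw => /eqP->; lia.
- by case/orP: e1 eqw => /eqP->; nia.
- by case/orP: e1 eqw => /eqP->; nia.
Qed.

(** * The two-segment polygon in integer inequalities *)

Lemma two_segment_polygonP p n j (f : {poly int}):
  (0 < j < n)%N -> f`_0 != 0 -> f`_n != 0 ->
  two_segment_polygon p n j f ->
  [/\ pval p f`_0 = 0, (f`_j != 0)%R,
      n * pval p f`_j < j * pval p f`_n,
      forall i, 0 < i < j -> (f`_i != 0)%R -> pval p f`_j * i < j * pval p f`_i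
    & forall i, j < i < n -> (f`_i != 0)%R ->
      (n - i) * pval p f`_j + (i - j) * pval p f`_n < (n - j) * pval p f`_i]%N.
Proof.
move=> /andP[j0 jn] f0 fn [].
have inv m : (0 < m)%N -> ((m%:R : rat)%:E^-1 = (m%:R^-1)%:E)%E.
  by move=> m0; rewrite inver pnatr_eq0 gtn_eqF.
have n0 : (0 < n)%N by lia.
rewrite /nu (negbTE f0) (negbTE fn) !inv // => -[/eqP v0] h1 _ h2 h3.
have fj : f`_j != 0.
  apply: contraTneq h3 => ->; rewrite eqxx gt0_mulye ?lte_fin ?invr_gt0 ?ltr0n //.
move: h1 h2 h3; rewrite (negbTE fj) => h1 h2 h3.
split=> //.
- by move: v0; rewrite pnatr_eq0 => /eqP.
- move: h3; rewrite -!EFinM lte_fin ltr_pdivlMr ?ltr0n // mulrAC.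
  by rewrite ltr_pdivrMr ?ltr0n // -!natrM ltr_nat mulnC (mulnC j).
- move=> i /[dup] /h1 {}h1 /andP[i0 ij] fi.
  move: h1; rewrite (negbTE fi) !inv // -!EFinM lte_fin ltr_pdivlMr ?ltr0n // mulrAC.
  by rewrite ltr_pdivrMr ?ltr0n // -!natrM ltr_nat (mulnC j).
- move=> i /[dup] /h2 {}h2 /andP[ji lin] fi.
  move: h2; rewrite (negbTE fi) -!EFinM -EFinD lte_fin.
  rewrite mulrAC [X in _ + X]mulrAC -mulrDl ltr_pdivrMr ?ltr0n ?subn_gt0 //.
  by rewrite -!natrM -natrD ltr_nat (mulnC (n - j)%N).
Qed.

(* [(i, v)] lies above the chord from [(j, u)] to [(n, w)], which itself runs
   above the line through the origin and [(j, u)]. *)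
Lemma chord_above n i j u v w : (0 < j < i)%N -> (i < n)%N ->
  ((n - i) * u + (i - j) * w < (n - j) * v)%N -> (n * u < j * w)%N ->
  (u * i < j * v)%N.
Proof.
move=> /andP[j0 ji] lin above slope.
have [b [c [ib nc]]] : exists b c, i = (j + b)%N /\ n = (i + c)%N.
  by exists (i - j)%N, (n - i)%N; lia.
subst i n; move: above; rewrite addKn -[(j + b + c)%N]addnA !addKn => above.
(* Since [(n - j) * i = c * j + b * n], the goal times [n - j] follows from [le_w] and [lt_v]. *)
have le_w := leq_mul (leqnn b) (ltnW slope).
have lt_v : (j * (c * u + b * w) < j * ((b + c) * v))%N.
  by rewrite ltn_pmul2l //; lia.
rewrite -(@ltn_pmul2l (b + c)%N); last by lia.
nia.
Qed.

(** Left of [j], the line of the first segment runs above the extension of the steeper second one.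
    Multiplied by [j], the inequality is the sum of [h1] and [h2]. *)
Lemma left_of_steep_line (n i j u v w : nat) : (0 < j)%N -> (i < j)%N ->
  (u * i <= j * v)%N -> (n * u < j * w)%N -> (j < n)%N ->
  (n%:Z - j%:Z) * u%:Z - (w%:Z - u%:Z) * j%:Z <
  (n%:Z - j%:Z) * v%:Z - (w%:Z - u%:Z) * i%:Z.
Proof.
move=> j0 ij le_i slope jn.
have h1 : 0 < (j%:Z - i%:Z) * (j%:Z * w%:Z - n%:Z * u%:Z) by rewrite mulr_gt0; lia.
have h2 : (n%:Z - j%:Z) * (u%:Z * i%:Z) <= (n%:Z - j%:Z) * (j%:Z * v%:Z).
  by rewrite ler_pM2l; lia.
have j0' : 0 < j%:Z by lia.
rewrite -(ltr_pM2l j0').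
nra.
Qed.

(** * Possible factor degrees for one prime *)

Lemma polygon_factor_degree p n j (f g h : {poly int}) d e :
  prime p -> (0 < j < n)%N -> f`_0 != 0 -> f`_n != 0 -> (size f <= n.+1)%N ->
  two_segment_polygon p n j f ->
  gcdn (pval p f`_j) j = 1%N ->
  gcdz ((pval p f`_n)%:Z - (pval p f`_j)%:Z) (n%:Z - j%:Z) = 1 ->
  f = g * h -> size g = d.+1 -> size h = e.+1 ->
  [\/ d = 0, d = j, d = (n - j)%N | d = n]%N.
Proof.
move=> pp jn f0 fn szf pol co1 co2 fE szg szh.
have [v0 fj slope seg1 seg2] := two_segment_polygonP jn f0 fn pol.
have /andP[j0 ltjn] := jn.
set vj := pval p f`_j in co1 co2 slope seg1 seg2.
set vn := pval p f`_n in co2 slope seg2.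
have nz (r : {poly int}) m : size r = m.+1 -> r != 0 by move=> sr; rewrite -size_poly_eq0 sr.
have [gn0 hn0] := (nz _ _ szg, nz _ _ szh).
have szf' : size f = n.+1.
  by apply/eqP; rewrite eqn_leq szf ltnNge; apply: contraNN fn => /leq_sizeP ->.
have den : (d + e = n)%N.
  by move: szf'; rewrite fE size_mul // szg szh; lia.
have gi_le (r : {poly int}) m i : size r = m.+1 -> r`_i != 0 -> (i <= m)%N.
  by move=> sr; rewrite leqNgt -sr; apply: contraNN => /leq_sizeP ->.
(* [W1] takes equal values at the ends of the first segment of [f], [W2] at those of the second. *)
pose W1 (r : {poly int}) i := weight p vj%:Z j%:Z r i.
pose W2 (r : {poly int}) i := weight p (vn%:Z - vj%:Z) (n%:Z - j%:Z) r i.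
pose N := n.+1.
have split_vertex A B ep k : (ep == 1) || (ep == -1) -> 0 < B ->
    vertex p (A * N%:Z + ep) (B * N%:Z) f k -> exists k1 k2,
    [/\ vertex p (A * N%:Z + ep) (B * N%:Z) g k1,
        vertex p (A * N%:Z + ep) (B * N%:Z) h k2, (k1 + k2 = k)%N &
        pval p f`_k = (pval p g`_k1 + pval p h`_k2)%N].
  move=> ep1 B0 vk.
  have [|k1 vk1] := @vertex_exists p A B ep N g ep1 gn0; first by lia.
  have [|k2 vk2] := @vertex_exists p A B ep N h ep1 hn0; first by lia.
  have BN : 0 < B * N%:Z by rewrite mulr_gt0.
  have := vertex_mul pp BN vk1 vk2; rewrite -fE => -[vk12 val].
  by exists k1, k2; have kE := vertex_uniq vk12 vk; rewrite -kE.
have posj : 0 < j%:Z by lia.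
have posnj : 0 < n%:Z - j%:Z by lia.
have weightN A B ep (r : {poly int}) i :
    weight p (A * N%:Z + ep) (B * N%:Z) r i = N%:Z * weight p A B r i - ep * i%:Z.
  by rewrite /weight; ring.
have W1f i : f`_i != 0 -> i != 0%N -> i != j -> 0 < W1 f i.
  move=> fi i0 ij; have i_n := gi_le _ _ _ szf' fi.
  rewrite /W1 /weight subr_gt0; have [lij|leji] := ltnP i j.
    by have := seg1 i _ fi; rewrite -!PoszM ltz_nat; apply; lia.
  have [->|i_ne_n] := eqVneq i n; first by rewrite -!PoszM ltz_nat mulnC.
  have s2 : ((n - i) * vj + (i - j) * vn < (n - j) * pval p f`_i)%N.
    by apply: seg2 => //; lia.
  by rewrite -!PoszM ltz_nat; apply: (chord_above _ _ s2 slope); lia.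
have W2jn : W2 f j = W2 f n by rewrite /W2 /weight -/vj -/vn; ring.
have W2f i : f`_i != 0 -> i != j -> i != n -> W2 f n < W2 f i.
  move=> fi ij i_n; have le_in := gi_le _ _ _ szf' fi.
  rewrite -W2jn /W2 /weight -/vj; have [lij|leji] := ltnP i j.
    have le_i : (vj * i <= j * pval p f`_i)%N.
      have [->|i0] := posnP i; first by rewrite muln0.
      by apply/ltnW/seg1; rewrite ?i0.
    by apply: left_of_steep_line le_i slope _.
  by have := seg2 i _ fi; move: (pval p f`_i) => v; lia.
have W10 : W1 f 0 = 0 by rewrite /W1 /weight v0; lia.
have W1j : W1 f j = 0 by rewrite /W1 /weight -/vj; lia.
(* The perturbation breaks the ties: [-1] favours the smaller index, [1] the larger. *)
have vert0 : vertex p (vj%:Z * N%:Z + -1) (j%:Z * N%:Z) f 0.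
  split=> // i fi i0; rewrite !weightN -/(W1 f 0) -/(W1 f i) W10.
  have [->|ij] := eqVneq i j; first by rewrite W1j; lia.
  by have := W1f i fi i0 ij; move: (W1 f i) => w; nia.
have vertj : vertex p (vj%:Z * N%:Z + 1) (j%:Z * N%:Z) f j.
  split=> // i fi ij; rewrite !weightN -/(W1 f j) -/(W1 f i) W1j.
  have i_n := gi_le _ _ _ szf' fi.
  have [->|i0] := eqVneq i 0%N; first by rewrite W10; lia.
  by have := W1f i fi i0 ij; move: (W1 f i) => w; rewrite /N; nia.
have vertn : vertex p ((vn%:Z - vj%:Z) * N%:Z + 1) ((n%:Z - j%:Z) * N%:Z) f n.
  split=> // i fi i_n; rewrite !weightN -/(W2 f n) -/(W2 f i).
  have le_in := gi_le _ _ _ szf' fi.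
  have [->|ij] := eqVneq i j; first by rewrite W2jn; lia.
  by have := W2f i fi ij i_n; move: (W2 f i) (W2 f n) => w w'; rewrite /N; nia.
have [g0 [h0 [vg0 vh0 /eqP]]] := split_vertex _ _ (-1) _ isT posj vert0.
rewrite addn_eq0 => /andP[/eqP g00 /eqP h00] val0; subst g0 h0.
have [k [l [vk vl klj valj]]] := split_vertex _ _ 1 _ isT posj vertj.
have [d' [e' [vd ve de' valn]]] := split_vertex _ _ 1 _ isT posnj vertn.
have led' := gi_le _ _ _ szg vd.1; have lee' := gi_le _ _ _ szh ve.1.
(* The bounds [d' <= d] and [e' <= e] are tight because both pairs sum to [n]. *)
have [dd' ee'] : d' = d /\ e' = e by lia.
subst d' e'.
have lekd := gi_le _ _ _ szg vk.1; have lele := gi_le _ _ _ szh vl.1.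
(* The perturbation contributes at most [n < N], so integrality of the weights recovers the
   unperturbed inequality. *)
have min1 (r : {poly int}) i : (i <= n)%N -> pval p r`_0 = 0%N -> r`_i != 0 ->
    vertex p (vj%:Z * N%:Z + -1) (j%:Z * N%:Z) r 0 -> 0 <= W1 r i.
  move=> le_in r0 ri vr; have := vertex_le vr ri; rewrite !weightN -/(W1 r i) -/(W1 r 0).
  have -> : W1 r 0 = 0 by rewrite /W1 /weight r0; lia.
  by move: (W1 r i) => w; rewrite /N; nia.
have min2 (r : {poly int}) m i : (i <= m <= n)%N -> r`_i != 0 ->
    vertex p ((vn%:Z - vj%:Z) * N%:Z + 1) ((n%:Z - j%:Z) * N%:Z) r m -> W2 r m <= W2 r i.
  move=> /andP[le_im le_mn] ri vr; have := vertex_le vr ri; rewrite !weightN -/(W2 r i) -/(W2 r m).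
  by move: (W2 r i) (W2 r m) => w w'; rewrite /N; nia.
(* Two nonnegative weights with sum [W1 f j = 0] both vanish; [Wgd] uses the same squeeze for
   [W2]. *)
have Wgk : W1 g k = 0.
  have : W1 g k + W1 h l = 0.
    by rewrite -W1j /W1 /weight valj -klj !PoszD; ring.
  have : 0 <= W1 g k by apply: min1 vk.1 vg0; lia.
  have : 0 <= W1 h l by apply: min1 vl.1 vh0; lia.
  by lia.
have Wgd : W2 g k = W2 g d.
  have : W2 g k + W2 h l = W2 g d + W2 h e.
    transitivity (W2 f n); last by rewrite /W2 /weight valn -den !PoszD; ring.
    by rewrite -W2jn /W2 /weight valj -klj !PoszD; ring.
  have : W2 g d <= W2 g k by apply: min2 vk.1 vd; lia.
  have : W2 h e <= W2 h l by apply: min2 vl.1 ve; lia.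
  by lia.
have jk : (j %| k)%N.
  have /Gauss_dvdr <- : coprime j vj by rewrite coprime_sym /coprime co1.
  apply/dvdnP; exists (pval p g`_k); move: Wgk; rewrite /W1 /weight; lia.
have njd : (n%:Z - j%:Z %| d%:Z - k%:Z)%Z.
  have /Gauss_dvdzr <- : coprimez (n%:Z - j%:Z) (vn%:Z - vj%:Z).
    by rewrite coprimez_sym /coprimez co2.
  apply/dvdzP; exists ((pval p g`_d)%:Z - (pval p g`_k)%:Z).
  by move: Wgd; rewrite /W2 /weight; lia.
case/dvdnP: jk => a ka; case/dvdzP: njd => b db.
(* Here [0 <= k <= j] bounds [a], while [k <= d] and [l <= e] give [0 <= d - k <= n - j], which
   bounds [b]. *)
have [a0|a1] : a = 0%N \/ a = 1%N by nia.
  have [b0|b1] : b = 0 \/ b = 1 by nia.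
    by constructor 1; nia.
  by constructor 3; nia.
have [b0|b1] : b = 0 \/ b = 1 by nia.
  by constructor 2; nia.
by constructor 4; nia.
Qed.

(** * Combining the two primes *)

Theorem theorem1p44 (n : nat) (f : {poly int}) (p q j1 j2 : nat)
  (f_size : (size f <= n.+1)%N)
  (f_ends : f`_0 * f`_n != 0)
  (p_prime : prime p) (q_prime : prime q) (p_neq_q : p != q)
  (j1_range : (1 <= j1 <= n.-1)%N) (j2_range : (1 <= j2 <= n.-1)%N)
  (j1_neq_j2 : j1 != j2) (j1_j2_sum : (j1 + j2)%N != n)
  (cond_i : two_segment_polygon p n j1 f)
  (cond_ii : two_segment_polygon q n j2 f)
  (cond_iii_p : gcdn (pval p f`_j1) j1 = 1%N /\
     gcdz ((pval p f`_n)%:Z - (pval p f`_j1)%:Z) (n%:Z - j1%:Z) = 1)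
  (cond_iii_q : gcdn (pval q f`_j2) j2 = 1%N /\
     gcdz ((pval q f`_n)%:Z - (pval q f`_j2)%:Z) (n%:Z - j2%:Z) = 1) :
  irreducible_poly (map_poly (intr : int -> rat) f).
Proof.
have /andP[nzf0 nzfn] : (f`_0 != 0) && (f`_n != 0) by rewrite -negb_or -mulf_eq0.
have szf : size f = n.+1.
  by apply/eqP; rewrite eqn_leq f_size ltnNge; apply: contraNN nzfn => /leq_sizeP ->.
have szQ (r : {poly int}) : size (map_poly (intr : int -> rat) r) = size r.
  by rewrite size_map_inj_poly //; exact: intr_inj.
have jn j : (1 <= j <= n.-1)%N -> (0 < j < n)%N by lia.
split=> [|u szu uf]; first by rewrite szQ szf; lia.
have [g [a a0 ug] [h fE]] := dvdpP_rat_int uf.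
have f0 : f != 0 by rewrite -size_poly_eq0 szf.
have /andP[g0 h0] : (g != 0) && (h != 0) by rewrite -negb_or -mulf_eq0 -fE.
have szS (r : {poly int}) : r != 0 -> size r = (size r).-1.+1.
  by move=> r0; rewrite prednK // lt0n size_poly_eq0.
have degp := polygon_factor_degree p_prime (jn _ j1_range) nzf0 nzfn f_size cond_i
  cond_iii_p.1 cond_iii_p.2 fE (szS g g0) (szS h h0).
have degq := polygon_factor_degree q_prime (jn _ j2_range) nzf0 nzfn f_size cond_ii
  cond_iii_q.1 cond_iii_q.2 fE (szS g g0) (szS h h0).
have sug : size u = size g by rewrite ug size_scale // szQ.
rewrite -(dvdp_size_eqp uf) szQ szf sug (szS g g0) eqSS.
have gn1 : (size g).-1 != 0%N by rewrite -eqSS -(szS g g0) -sug.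
clear -gn1 degp degq j1_neq_j2 j1_j2_sum j1_range j2_range.
(* As [j1] differs from [j2] and from [n - j2], the two lists of degrees share only 0 and [n], and
   [gn1] excludes 0. *)
by case: degp => gd; case: degq => gd'; lia.
Qed.
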